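(* Let $q>1$ be real and let $p\ge5$ be an odd prime. Assume there exists $\alpha\in(0,\tfrac12)$ such that $$\cos^2\!\Big(\frac{\pi\alpha}{2}\Big)\ge q^{-2},\qquad \sin^2(\pi\alpha)\sum_{i\ge2}\frac{q^{-i}}{i^2}\ge q^{-4-\alpha}.$$ Define $$T_3(q,\alpha):=\sup_{|x-p|\le\alpha}\ \sum_{i\ge2}q^{-i}\,\bigl|\phi_i^{(3)}(x)\bigr|,\qquad K(q,p):=\tfrac12\Big(S_q''(p)-(\log q)^2q^{-p}\Big),$$ and assume in addition that $$\alpha\le\frac{K(q,p)}{T_3(q,\alpha)+(\log q)^3q^{-p}}.$$ Then $\mathfrak F(\cdot,q)$ has exactly one real zero in $(p-1,p)$.
   Context: For $z\in\mathbb C$ and an integer $i\ge2$, $F(z,i)=i+2\sum_{k=1}^{i-1}(i-k)\cos(2\pi kz/i)$ and $\phi_i(z)=F(z,i)/i^2$; $\phi_i^{(3)}$ is the third derivative. $S_q(x)=\sum_{i\ge2}q^{-i}\phi_i(x)$. For $q>1$, $$\mathfrak F(x,q)=(q-1)q\bigl(S_q(x)-q^{-x}\bigr).$$ *)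

(* Defs.v *)
From Stdlib Require Import Reals ZArith Znumtheory.
From Coquelicot Require Import Coquelicot.
Open Scope R_scope.

(* All functions are taken on the real line: only real arguments, real
   derivatives and real zeros are considered. The definitions are meant for
   [2 <= i]. *)

Definition F (z : R) (i : nat) : R :=
  INR i
  + 2 * sum_n_m (fun k : nat => (INR i - INR k) * cos (2 * PI * INR k * z / INR i))
          1 (i - 1).

Definition phi (i : nat) (z : R) : R := F z i / INR i ^ 2.

(* [sum_from_2 a] is the sum of [a i] over [i >= 2]. Every series to which it is
   applied converges absolutely when [1 < q], since [0 <= phi i x <= 1] and
   [Rabs (Derive_n (phi i) 3 x) <= (2 * PI) ^ 3]. *)
Definition sum_from_2 (a : nat -> R) : R := Series (fun n : nat => a (n + 2)%nat).

Definition Sq (q x : R) : R := sum_from_2 (fun i => / q ^ i * phi i x).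

Definition frakF (x q : R) : R := (q - 1) * q * (Sq q x - Rpower q (- x)).

(* The supremum is finite (see [sum_from_2]) and, for [0 <= alpha], taken over
   a nonempty set, so that [real] loses nothing. *)
Definition T3 (p : Z) (q alpha : R) : R :=
  real (Lub_Rbar (fun y : R => exists x : R,
    Rabs (x - IZR p) <= alpha /\
    y = sum_from_2 (fun i => / q ^ i * Rabs (Derive_n (phi i) 3 x)))).

Definition K (q : R) (p : Z) : R :=
  / 2 * (Derive_n (Sq q) 2 (IZR p) - ln q ^ 2 * Rpower q (- IZR p)).

(* Main.v *)
Require Import Defs.
From Stdlib Require Import Reals ZArith Znumtheory Lra Lia.
From Coquelicot Require Import Coquelicot.
Open Scope R_scope.

(** The function [phi i] is the Fejer kernel
    [sin (PI * x) ^ 2 / (i * sin (PI * x / i)) ^ 2]. Hence it lies in [[0, 1]], and at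
    an integer [z] it is [1] if [i] divides [z] and [0] otherwise; in both cases its
    derivative vanishes there, the integer being an extremum. For a prime [p] only
    [i = p] contributes to [Sq q p], so [G x = Sq q x - q ^ -x] has a zero at [p]
    with slope [ln q * q ^ -p > 0], and [frakF x q] is a positive multiple of
    [G x].

    Write [p - 1 = 2 * k]. On [(p - 1, p - 1 + alpha]] the single term
    [q ^ -2 * phi 2 x], with [phi 2 x = cos (PI * x / 2) ^ 2], is at least
    [q ^ -4 > q ^ -x] ([Sq_gt_near_even]). On [(p - 1 + alpha, p - alpha]] the bound
    [phi i x >= sin (PI * x) ^ 2 / i ^ 2] gives [Sq q x >= q ^ (-4 - alpha) > q ^ -x]
    ([Sq_gt_middle]). So [G] is positive up to [p - alpha]. On [[p - alpha, p]] it
    is strictly convex ([second_derivative_margin]); as it vanishes at [p] with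
    positive slope, it has exactly one zero in between ([unique_zero_before]).

    Differentiating [Sq q] three times term by term rests on the fact that [phi i] is a
    cosine polynomial of frequencies at most [2 * PI], so that the derivatives of
    order [m] are bounded by [(2 * PI) ^ m] uniformly in [i] and [x]
    ([is_derive_Series], [phi_der_bound_all]). *)

(** * Finite sums *)

Lemma sum_from_1_S (a : nat -> R) n :
  sum_n_m a 1 (S n) = sum_n_m a 1 n + a (S n) :> R.
Proof. rewrite sum_n_Sm; [reflexivity | lia]. Qed.

Lemma sum_from_1_0 (a : nat -> R) : sum_n_m a 1 0 = 0 :> R.
Proof. rewrite sum_n_m_zero; [reflexivity | lia]. Qed.

Lemma sum_from_1_shift_weight (c : nat -> R) t n :
  sum_n_m (fun k => (t + 1 - INR k) * c k) 1 n
  = sum_n_m (fun k => (t - INR k) * c k) 1 n + sum_n_m c 1 n :> R.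
Proof.
induction n as [|n IH].
- rewrite !sum_from_1_0; ring.
- rewrite !sum_from_1_S, IH; ring.
Qed.

Lemma Rabs_sum_from_1_le (a : nat -> R) B n :
  (forall k, (1 <= k <= n)%nat -> Rabs (a k) <= B) ->
  Rabs (sum_n_m a 1 n) <= INR n * B.
Proof.
induction n as [|n IH]; intros H.
- rewrite sum_from_1_0, Rabs_R0; simpl; lra.
- rewrite sum_from_1_S, S_INR.
  assert (H1 := IH (fun k Hk => H k ltac:(lia))).
  assert (H2 := H (S n) ltac:(lia)).
  assert (H3 := Rabs_triang (sum_n_m a 1 n) (a (S n))); lra.
Qed.

Lemma is_derive_sum_from_1 (f g : nat -> R -> R) n x :
  (forall k, is_derive (f k) x (g k x)) ->
  is_derive (fun y => sum_n_m (fun k => f k y) 1 n) x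
    (sum_n_m (fun k => g k x) 1 n).
Proof.
intros H; induction n as [|n IH].
- rewrite sum_from_1_0.
  apply is_derive_ext with (fun _ : R => 0).
  + intros t; rewrite sum_from_1_0; reflexivity.
  + apply (is_derive_const 0 x).
- rewrite sum_from_1_S.
  apply is_derive_ext with (fun y => sum_n_m (fun k => f k y) 1 n + f (S n) y).
  + intros t; rewrite sum_from_1_S; reflexivity.
  + exact (is_derive_plus _ _ _ _ _ IH (H (S n))).
Qed.

(** * The Fejer kernel *)

Lemma dirichlet_kernel a n :
  (1 + 2 * sum_n_m (fun k => cos (2 * INR k * a)) 1 n) * sin a
  = sin ((2 * INR n + 1) * a).
Proof.
induction n as [|n IH].
- rewrite sum_from_1_0; simpl INR.
  replace ((2 * 0 + 1) * a) with a by ring; ring.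
- rewrite sum_from_1_S.
  replace (sin ((2 * INR (S n) + 1) * a)) with
    (sin ((2 * INR n + 1) * a) + 2 * cos (2 * INR (S n) * a) * sin a).
  + rewrite <- IH; ring.
  + replace ((2 * INR n + 1) * a) with (2 * INR (S n) * a - a)
      by (rewrite S_INR; ring).
    replace ((2 * INR (S n) + 1) * a) with (2 * INR (S n) * a + a) by ring.
    rewrite sin_minus, sin_plus; ring.
Qed.

(** Consecutive left-hand sides differ by a Dirichlet kernel times [sin a],
    consecutive right-hand sides by a product of two sines. *)
Lemma fejer_kernel a n :
  (INR (S n)
   + 2 * sum_n_m (fun k => (INR (S n) - INR k) * cos (2 * INR k * a)) 1 n)
  * sin a ^ 2 = sin (INR (S n) * a) ^ 2.
Proof.
induction n as [|n IH].
- rewrite sum_from_1_0; simpl INR.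
  replace (1 * a) with a by ring; ring.
- rewrite sum_from_1_S.
  rewrite (sum_n_m_ext _ (fun k => (INR (S n) + 1 - INR k)
             * cos (2 * INR k * a)) 1 n)
    by (intros k; rewrite (S_INR (S n)); reflexivity).
  rewrite sum_from_1_shift_weight.
  assert (HD := dirichlet_kernel a (S n)).
  rewrite sum_from_1_S in HD.
  replace (sin (INR (S (S n)) * a) ^ 2)
    with (sin (INR (S n) * a) ^ 2 + sin ((2 * INR (S n) + 1) * a) * sin a).
  + rewrite <- IH, <- HD, (S_INR (S n)); ring.
  + replace ((2 * INR (S n) + 1) * a) with (INR (S n) * a + (INR (S n) * a + a))
      by ring.
    replace (INR (S (S n)) * a) with (INR (S n) * a + a)
      by (rewrite (S_INR (S n)); ring).
    assert (H2 := sin2_cos2 a).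
    unfold Rsqr in H2.
    rewrite (sin_plus (INR (S n) * a) (INR (S n) * a + a)).
    rewrite (sin_plus (INR (S n) * a) a), (cos_plus (INR (S n) * a) a).
    set (u := sin (INR (S n) * a)); set (v := cos (INR (S n) * a)).
    assert (Hc : cos a ^ 2 = 1 - sin a ^ 2) by (simpl; lra).
    ring [Hc].
Qed.

Lemma phi_pos_index n x :
  phi (S n) x = (INR (S n)
   + 2 * sum_n_m (fun k => (INR (S n) - INR k)
           * cos (2 * INR k * (PI * x / INR (S n)))) 1 n) / INR (S n) ^ 2.
Proof.
unfold phi, F.
replace (S n - 1)%nat with n by lia.
rewrite (sum_n_m_ext _ (fun k => (INR (S n) - INR k)
           * cos (2 * INR k * (PI * x / INR (S n)))) 1 n); [reflexivity|].
intros k; do 2 f_equal.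
assert (INR (S n) <> 0) by (apply not_0_INR; lia).
field; assumption.
Qed.

Lemma phi_fejer i x : (1 <= i)%nat ->
  phi i x * INR i ^ 2 * sin (PI * x / INR i) ^ 2 = sin (PI * x) ^ 2.
Proof.
intros Hi; destruct i as [|n]; [lia|].
assert (HN : INR (S n) <> 0) by (apply not_0_INR; lia).
replace (PI * x) with (INR (S n) * (PI * x / INR (S n))) at 2 by (field; auto).
rewrite <- fejer_kernel, phi_pos_index.
field; assumption.
Qed.

Lemma sin_mult_eq_0 a k : sin a = 0 -> sin (INR k * a) = 0.
Proof.
intros H; induction k as [|k IH].
- simpl; rewrite Rmult_0_l; apply sin_0.
- rewrite S_INR.
  replace ((INR k + 1) * a) with (INR k * a + a) by ring.
  rewrite sin_plus, IH, H; ring.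
Qed.

Lemma phi_eq_1 i x : (1 <= i)%nat -> sin (PI * x / INR i) = 0 -> phi i x = 1.
Proof.
intros Hi H; destruct i as [|n]; [lia|].
assert (HN : INR (S n) <> 0) by (apply not_0_INR; lia).
rewrite phi_pos_index.
set (a := PI * x / INR (S n)) in *.
rewrite (sum_n_m_ext _ (fun k => (INR (S n) - INR k) * 1) 1 n).
- assert (HS : 2 * sum_n_m (fun k => (INR (S n) - INR k) * 1) 1 n
               = INR (S n) * INR n).
  { clear. induction n as [|n IH].
    - rewrite sum_from_1_0; simpl; ring.
    - rewrite sum_from_1_S.
      rewrite (sum_n_m_ext _ (fun k => (INR (S n) + 1 - INR k) * 1) 1 n)
        by (intros k; rewrite (S_INR (S n)); reflexivity).
      rewrite sum_from_1_shift_weight.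
      assert (HC : sum_n_m (fun _ => 1) 1 n = INR n :> R).
      { rewrite sum_n_m_const. replace (S n - 1)%nat with n by lia. ring. }
      rewrite HC, !Rmult_plus_distr_l, IH, !S_INR; ring. }
  rewrite HS, S_INR in *; field; exact HN.
- intros k; f_equal.
  replace (2 * INR k * a) with (2 * (INR k * a)) by ring.
  rewrite cos_2a_sin, sin_mult_eq_0 by exact H; ring.
Qed.

Lemma phi_nonneg i x : (1 <= i)%nat -> 0 <= phi i x.
Proof.
intros Hi.
destruct (Req_dec (sin (PI * x / INR i)) 0) as [H0|H0].
- rewrite phi_eq_1; auto; lra.
- assert (HN : 0 < INR i) by (apply lt_0_INR; lia).
  assert (HF := phi_fejer i x Hi).
  assert (0 <= sin (PI * x) ^ 2) by apply pow2_ge_0.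
  assert (0 < INR i ^ 2 * sin (PI * x / INR i) ^ 2).
  { apply Rmult_lt_0_compat; [apply pow_lt; auto|].
    rewrite <- Rsqr_pow2; apply Rsqr_pos_lt; auto. }
  destruct (Rle_or_lt 0 (phi i x)); auto. nra.
Qed.

Lemma phi_le_1 i x : (1 <= i)%nat -> phi i x <= 1.
Proof.
intros Hi.
destruct i as [|n]; [lia|].
(* Compare with the value at [0], where every cosine is [1]. *)
rewrite <- (phi_eq_1 (S n) 0 Hi)
  by (replace (PI * 0 / INR (S n)) with 0 by (unfold Rdiv; ring); apply sin_0).
rewrite !phi_pos_index.
apply Rmult_le_compat_r.
{ apply Rlt_le, Rinv_0_lt_compat, pow_lt, lt_0_INR; lia. }
apply Rplus_le_compat_l, Rmult_le_compat_l; [lra|].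
assert (HH : forall m, (m <= n)%nat ->
  sum_n_m (fun k => (INR (S n) - INR k) * cos (2 * INR k * (PI * x / INR (S n)))) 1 m
  <= sum_n_m (fun k => (INR (S n) - INR k) * cos (2 * INR k * (PI * 0 / INR (S n)))) 1 m).
{ induction m as [|m IH]; intros Hm.
  - rewrite !sum_from_1_0; lra.
  - rewrite !sum_from_1_S.
    apply Rplus_le_compat; [apply IH; lia|].
    apply Rmult_le_compat_l.
    + assert (INR (S m) <= INR (S n)) by (apply le_INR; lia); lra.
    + replace (2 * INR (S m) * (PI * 0 / INR (S n))) with 0 by (unfold Rdiv; ring).
      rewrite cos_0; apply COS_bound. }
apply HH; lia.
Qed.

Lemma phi_lower_bound i x : (1 <= i)%nat ->
  sin (PI * x) ^ 2 / INR i ^ 2 <= phi i x.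
Proof.
intros Hi.
assert (HN : 0 < INR i ^ 2) by (apply pow_lt, lt_0_INR; lia).
apply Rle_div_l; [exact HN|].
rewrite <- (phi_fejer i x Hi).
assert (Hp := phi_nonneg i x Hi).
assert (Hs := SIN_bound (PI * x / INR i)).
assert (sin (PI * x / INR i) ^ 2 <= 1) by nra.
assert (0 <= phi i x * INR i ^ 2) by (apply Rmult_le_pos; lra).
nra.
Qed.

Lemma phi_at_integer i z : (1 <= i)%nat ->
  sin (PI * IZR z / INR i) <> 0 -> phi i (IZR z) = 0.
Proof.
intros Hi H.
assert (HF := phi_fejer i (IZR z) Hi).
assert (Hz : sin (PI * IZR z) = 0).
{ apply sin_eq_0_1; exists z; ring. }
rewrite Hz in HF.
assert (HN : INR i <> 0) by (apply not_0_INR; lia).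
assert (HN2 := pow_nonzero _ 2 HN).
assert (Hs2 := pow_nonzero _ 2 H).
replace (0 ^ 2) with 0 in HF by ring.
apply Rmult_integral in HF; destruct HF as [HF|HF]; [|contradiction].
apply Rmult_integral in HF; destruct HF as [HF|HF]; [exact HF | contradiction].
Qed.

Lemma phi_prime (p : Z) i : prime p -> (2 <= i)%nat -> i <> Z.to_nat p ->
  phi i (IZR p) = 0.
Proof.
intros Hp Hi Hne.
apply phi_at_integer; [lia|]; intros H0.
destruct (sin_eq_0_0 _ H0) as [k Hk].
assert (HN : INR i <> 0) by (apply not_0_INR; lia).
assert (HPI := PI_RGT_0).
assert (E : p = (k * Z.of_nat i)%Z).
{ apply eq_IZR; rewrite mult_IZR, <- INR_IZR_INZ.
  apply Rmult_eq_reg_l with PI; [|lra].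
  transitivity (PI * IZR p / INR i * INR i); [field; auto|].
  rewrite Hk; ring. }
assert (Hd : (Z.of_nat i | p)%Z) by (exists k; exact E).
apply prime_divisors in Hd; [|exact Hp].
assert (2 <= p)%Z by (destruct Hp; lia).
lia.
Qed.

Lemma phi_self (p : Z) : (1 <= p)%Z -> phi (Z.to_nat p) (IZR p) = 1.
Proof.
intros Hp; apply phi_eq_1; [lia|].
rewrite INR_IZR_INZ, Z2Nat.id by lia.
replace (PI * IZR p / IZR p) with PI
  by (field; apply not_0_IZR; lia).
apply sin_PI.
Qed.

Lemma phi_2 x : phi 2 x = cos (PI * x / 2) ^ 2.
Proof.
rewrite phi_pos_index, sum_from_1_S, sum_from_1_0.
simpl INR.
replace (2 * 1 * (PI * x / (1 + 1))) with (2 * (PI * x / 2)) by field.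
rewrite cos_2a_cos; field.
Qed.

(** * Derivatives of the Fejer kernel *)

(** The shift of the argument by [m * PI / 2] makes all orders instances of one
    formula, up to the constant term, which only survives at order [0]. *)
Definition phi_der (m i : nat) (x : R) : R :=
  (match m with O => INR i | _ => 0 end
   + 2 * sum_n_m (fun k => (INR i - INR k) * (2 * PI * INR k / INR i) ^ m
           * cos (2 * PI * INR k / INR i * x + INR m * (PI / 2))) 1 (i - 1))
  / INR i ^ 2.

Lemma phi_der_0 i x : phi_der 0 i x = phi i x.
Proof.
unfold phi_der, phi, F.
do 3 f_equal.
apply sum_n_m_ext; intros k; simpl.
replace (2 * PI * INR k / INR i * x + 0 * (PI / 2))
  with (2 * PI * INR k * x / INR i) by (unfold Rdiv; ring).
ring.
Qed.

Lemma is_derive_phi_der m i x :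
  is_derive (phi_der m i) x (phi_der (S m) i x).
Proof.
unfold phi_der.
set (w := fun k => 2 * PI * INR k / INR i).
set (c := match m with O => INR i | _ => 0 end).
assert (HD := is_derive_sum_from_1
  (fun k y => (INR i - INR k) * w k ^ m * cos (w k * y + INR m * (PI / 2)))
  (fun k y => (INR i - INR k) * w k ^ S m * cos (w k * y + INR (S m) * (PI / 2)))
  (i - 1) x).
assert (HD' : forall k, is_derive
  (fun y => (INR i - INR k) * w k ^ m * cos (w k * y + INR m * (PI / 2))) x
  ((INR i - INR k) * w k ^ S m * cos (w k * x + INR (S m) * (PI / 2)))).
{ intros k.
  replace (w k * x + INR (S m) * (PI / 2))
    with (PI / 2 + (w k * x + INR m * (PI / 2))) by (rewrite S_INR; ring).
  replace (cos (PI / 2 + (w k * x + INR m * (PI / 2))))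
    with (- sin (w k * x + INR m * (PI / 2)))
    by (rewrite (sin_cos (w k * x + INR m * (PI / 2))); ring).
  auto_derive; [exact I|].
  simpl; ring. }
specialize (HD HD').
evar_last.
- apply (is_derive_ext (fun y => scal (/ INR i ^ 2)
    (plus c (scal 2 (sum_n_m (fun k => (INR i - INR k) * w k ^ m
       * cos (w k * y + INR m * (PI / 2))) 1 (i - 1)))))).
  + intros t; unfold scal, plus; simpl; unfold mult; simpl.
    unfold Rdiv; rewrite Rmult_comm; reflexivity.
  + apply is_derive_scal.
    apply (is_derive_plus (V := R_NormedModule)); [apply is_derive_const|].
    apply is_derive_scal, HD.
- match goal with |- ?a = ?b => change (a = b :> R) end.
  change (/ INR i ^ 2 * (0 + 2 * sum_n_m (fun k => (INR i - INR k) * w k ^ S m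
            * cos (w k * x + INR (S m) * (PI / 2))) 1 (i - 1))
    = (0 + 2 * sum_n_m (fun k => (INR i - INR k) * w k ^ S m
            * cos (w k * x + INR (S m) * (PI / 2))) 1 (i - 1)) / INR i ^ 2).
  apply Rmult_comm.
Qed.

(** Since [k * (i - k) <= i ^ 2 / 4] and the sum has fewer than [i] terms. The
    factor [1 / 2] is what lets the term of index [2] dominate all later ones in
    [Sq_der_2_lower_bound]. *)
Lemma phi_der_bound m i x : (1 <= i)%nat ->
  Rabs (phi_der (S m) i x) <= (2 * PI) ^ S m / 2.
Proof.
intros Hi.
assert (HPI := PI_RGT_0).
assert (HN : 0 < INR i) by (apply lt_0_INR; lia).
assert (HP : 0 < (2 * PI) ^ S m) by (apply pow_lt; lra).
unfold phi_der.
rewrite Rplus_0_l; unfold Rdiv at 1.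
rewrite Rabs_mult, Rabs_mult, (Rabs_pos_eq 2), (Rabs_pos_eq (/ INR i ^ 2))
  by (try lra; apply Rlt_le, Rinv_0_lt_compat, pow_lt; auto).
assert (HS := Rabs_sum_from_1_le
  (fun k => (INR i - INR k) * (2 * PI * INR k / INR i) ^ S m
     * cos (2 * PI * INR k / INR i * x + INR (S m) * (PI / 2)))
  ((2 * PI) ^ S m * (INR i / 4)) (i - 1)).
assert (HS' : Rabs (sum_n_m (fun k => (INR i - INR k) * (2 * PI * INR k / INR i) ^ S m
     * cos (2 * PI * INR k / INR i * x + INR (S m) * (PI / 2))) 1 (i - 1))
   <= INR i * ((2 * PI) ^ S m * (INR i / 4))).
{ eapply Rle_trans; [apply HS|].
  - intros k Hk.
    assert (Hk0 : 0 < INR k) by (apply lt_0_INR; lia).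
    assert (Hki : INR k <= INR i) by (apply le_INR; lia).
    assert (Hr : 0 <= INR k / INR i <= 1).
    { split; [apply Rlt_le, Rdiv_lt_0_compat; auto|].
      apply Rle_div_l; lra. }
    replace (2 * PI * INR k / INR i) with (2 * PI * (INR k / INR i))
      by (unfold Rdiv; ring).
    rewrite Rpow_mult_distr, !Rabs_mult.
    rewrite (Rabs_pos_eq (INR i - INR k)), (Rabs_pos_eq ((2 * PI) ^ S m)) by lra.
    rewrite (Rabs_pos_eq ((INR k / INR i) ^ S m)) by (apply pow_le; lra).
    assert (Hc : Rabs (cos (2 * PI * (INR k / INR i) * x + INR (S m) * (PI / 2))) <= 1).
    { apply Rabs_le, COS_bound. }
    assert (Hm : 0 <= (INR k / INR i) ^ S m <= INR k / INR i).
    { split; [apply pow_le; lra|]. simpl.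
      assert (Hm1 : 0 <= (INR k / INR i) ^ m <= 1).
      { split; [apply pow_le; lra|]. rewrite <- (pow1 m). apply pow_incr; lra. }
      nra. }
    assert (Hq : (INR i - INR k) * (INR k / INR i) <= INR i / 4).
    { replace ((INR i - INR k) * (INR k / INR i))
        with ((INR i - INR k) * INR k / INR i) by (unfold Rdiv; ring).
      apply Rle_div_l; [auto|].
      assert (0 <= (INR i - 2 * INR k) ^ 2) by apply pow2_ge_0. nra. }
    assert (Hq' : (INR i - INR k) * (INR k / INR i) ^ S m <= INR i / 4).
    { eapply Rle_trans; [|exact Hq]. apply Rmult_le_compat_l; lra. }
    assert (Hq0 : 0 <= (INR i - INR k) * (INR k / INR i) ^ S m)
      by (apply Rmult_le_pos; lra).
    set (A := (INR k / INR i) ^ S m) in *.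
    set (P := (2 * PI) ^ S m) in *.
    set (C := Rabs (cos _)) in *.
    assert (HC0 : 0 <= C) by apply Rabs_pos.
    replace ((INR i - INR k) * (P * A) * C) with (P * ((INR i - INR k) * A * C)) by ring.
    apply Rmult_le_compat_l; [lra|]. nra.
  - apply Rmult_le_compat_r; [|apply le_INR; lia].
    apply Rmult_le_pos; lra. }
apply (Rle_div_l (2 * Rabs _) _ (INR i ^ 2)); [apply pow_lt; auto|].
nra.
Qed.

Lemma Derive_n_unfolded (f : nat -> R -> R) (g : R -> R) m x :
  (forall n y, is_derive (f n) y (f (S n) y)) -> (forall y, f O y = g y) ->
  Derive_n g m x = f m x.
Proof.
intros Hf Hg; revert x; induction m as [|m IH]; intros x.
- symmetry; apply Hg.
- simpl; rewrite (Derive_ext _ (f m)) by exact IH.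
  apply is_derive_unique, Hf.
Qed.

Lemma Derive_n_phi m i x : Derive_n (phi i) m x = phi_der m i x.
Proof.
apply (Derive_n_unfolded (fun m => phi_der m i)).
- intros; apply is_derive_phi_der.
- intros; apply phi_der_0.
Qed.

(** Every integer is a minimum or a maximum of [phi i], whose range is contained
    in [[0, 1]] and which only takes the values [0] and [1] on integers. *)
Lemma phi_der_1_at_integer i z : (1 <= i)%nat -> phi_der 1 i (IZR z) = 0.
Proof.
intros Hi.
assert (Hd : is_derive (phi i) (IZR z) (phi_der 1 i (IZR z))).
{ apply is_derive_ext with (phi_der 0 i).
  - intros; apply phi_der_0.
  - apply is_derive_phi_der. }
assert (pr : derivable_pt (phi i) (IZR z)).
{ exists (phi_der 1 i (IZR z)). apply is_derive_Reals, Hd. }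
rewrite <- (is_derive_unique _ _ _ Hd), <- (Derive_Reals _ _ pr).
destruct (Req_dec (sin (PI * IZR z / INR i)) 0) as [H0|H0].
- apply deriv_maximum with (IZR z - 1) (IZR z + 1); try lra.
  intros x _ _; rewrite (phi_eq_1 i (IZR z)) by assumption.
  apply phi_le_1, Hi.
- apply deriv_minimum with (IZR z - 1) (IZR z + 1); try lra.
  intros x _ _; rewrite (phi_at_integer i z) by assumption.
  apply phi_nonneg, Hi.
Qed.

(** * Termwise differentiation *)

(** A uniform summable bound on the second derivatives makes the Taylor remainders
    of order two summable: the sum differs from its tangent at [x] by at most
    [Series M * (y - x) ^ 2]. *)
Lemma is_derive_Series (f f1 f2 : nat -> R -> R) (M : nat -> R) x :
  (forall n y, is_derive (f n) y (f1 n y)) ->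
  (forall n y, is_derive (f1 n) y (f2 n y)) ->
  (forall n y, Rabs (f2 n y) <= M n) ->
  ex_series M ->
  (forall y, ex_series (fun n => f n y)) ->
  ex_series (fun n => f1 n x) ->
  is_derive (fun y => Series (fun n => f n y)) x (Series (fun n => f1 n x)).
Proof.
intros H1 H2 HM eM ef ef1.
assert (Hlip : forall n y, Rabs (f1 n y - f1 n x) <= M n * Rabs (y - x)).
{ intros n y.
  destruct (MVT_gen (f1 n) x y (f2 n)) as [c [_ Hc]].
  - intros; apply H2.
  - intros t _; apply continuity_pt_filterlim.
    apply (ex_derive_continuous (f1 n)); exists (f2 n t); apply H2.
  - rewrite Hc, Rabs_mult.
    apply Rmult_le_compat_r; [apply Rabs_pos | apply HM]. }
assert (Htay : forall n y,
  Rabs (f n y - f n x - (y - x) * f1 n x) <= M n * (y - x) ^ 2).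
{ intros n y.
  destruct (MVT_gen (f n) x y (f1 n)) as [c [Hcb Hc]].
  - intros; apply H1.
  - intros t _; apply continuity_pt_filterlim.
    apply (ex_derive_continuous (f n)); exists (f1 n t); apply H1.
  - rewrite Hc.
    replace (f1 n c * (y - x) - (y - x) * f1 n x)
      with ((f1 n c - f1 n x) * (y - x)) by ring.
    rewrite Rabs_mult, <- pow2_abs.
    assert (Hl := Hlip n c).
    assert (HM0 : 0 <= M n) by (eapply Rle_trans; [apply Rabs_pos | apply (HM n x)]).
    assert (Hcx : Rabs (c - x) <= Rabs (y - x)).
    { unfold Rmin, Rmax in Hcb; destruct (Rle_dec x y);
        unfold Rabs; destruct (Rcase_abs (c - x)), (Rcase_abs (y - x)); lra. }
    assert (H0 := Rabs_pos (y - x)).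
    simpl; rewrite Rmult_1_r, <- Rmult_assoc.
    apply Rmult_le_compat_r; [exact H0|].
    eapply Rle_trans; [exact Hl|]. apply Rmult_le_compat_l; assumption. }
assert (HSum : forall y, Rabs (Series (fun n => f n y) - Series (fun n => f n x)
    - (y - x) * Series (fun n => f1 n x)) <= Series M * (y - x) ^ 2).
{ intros y.
  rewrite <- Series_minus, <- Series_scal_l, <- Series_minus; auto.
  2: apply (ex_series_minus (V := R_NormedModule)); auto.
  2: apply (ex_series_scal_l (V := R_NormedModule)); auto.
  assert (eb : ex_series (fun n => M n * (y - x) ^ 2)).
  { apply ex_series_scal_r, eM. }
  rewrite <- Series_scal_r.
  eapply Rle_trans; [apply Series_Rabs|].
  - apply (ex_series_le (V := R_CompleteNormedModule)) with (2 := eb).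
    intros n; unfold norm; simpl; unfold abs; simpl.
    rewrite Rabs_Rabsolu; apply Htay.
  - apply Series_le; [|exact eb].
    intros n; split; [apply Rabs_pos | apply Htay]. }
apply is_derive_Reals; intros eps Heps.
assert (HS0 : 0 <= Series M).
{ replace 0 with (Series (fun n => 0 * M n)) by (rewrite Series_scal_l; ring).
  apply Series_le; [|exact eM]. intros n.
  assert (0 <= M n) by (eapply Rle_trans; [apply Rabs_pos | apply (HM n x)]); lra. }
assert (Hd : 0 < eps / (Series M + 1)) by (apply Rdiv_lt_0_compat; lra).
exists (mkposreal _ Hd); simpl; intros h Hh0 Hh.
assert (HS := HSum (x + h)).
replace (x + h - x) with h in HS by ring.
assert (Hpos := Rabs_pos_lt h Hh0).
replace ((Series (fun n => f n (x + h)) - Series (fun n => f n x)) / h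
   - Series (fun n => f1 n x))
  with ((Series (fun n => f n (x + h)) - Series (fun n => f n x)
   - h * Series (fun n => f1 n x)) / h) by (field; auto).
unfold Rdiv; rewrite Rabs_mult, Rabs_inv.
apply Rlt_div_l; [exact Hpos|].
eapply Rle_lt_trans; [exact HS|].
rewrite <- pow2_abs; simpl; rewrite Rmult_1_r, <- Rmult_assoc.
apply Rmult_lt_compat_r; [exact Hpos|].
apply Rlt_div_r in Hh; [|lra].
nra.
Qed.

Lemma is_series_single (a : nat -> R) N :
  (forall n, n <> N -> a n = 0) -> is_series a (a N).
Proof.
intros H.
assert (H0 : forall n, (n < N)%nat -> sum_n a n = 0 :> R).
{ induction n as [|n IH]; intros Hn.
  - rewrite sum_O; apply H; lia.
  - rewrite sum_Sn, IH, H by lia. apply Rplus_0_l. }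
assert (H1 : forall k, sum_n a (N + k) = a N).
{ induction k as [|k IH].
  - rewrite Nat.add_0_r; destruct N as [|N'].
    + apply sum_O.
    + rewrite sum_Sn, H0 by lia. apply Rplus_0_l.
  - rewrite Nat.add_succ_r, sum_Sn, IH, (H (S (N + k))) by lia. apply Rplus_0_r. }
change (is_lim_seq (sum_n a) (a N)).
apply (is_lim_seq_ext_loc (fun _ => a N)); [|apply is_lim_seq_const].
exists N; intros n Hn.
replace n with (N + (n - N))%nat by lia; rewrite H1; reflexivity.
Qed.

(** * The series of Fejer kernels and its derivatives *)

Lemma geometric_weight_pos q i : 1 < q -> 0 < / q ^ i.
Proof. intros hq; apply Rinv_0_lt_compat, pow_lt; lra. Qed.

Lemma is_series_geometric_weight q j : 1 < q ->
  is_series (fun n => / q ^ (n + j)) (/ q ^ j / (1 - / q)).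
Proof.
intros hq.
assert (Hq : Rabs (/ q) < 1).
{ rewrite Rabs_pos_eq by (apply Rlt_le, Rinv_0_lt_compat; lra).
  rewrite <- Rinv_1; apply Rinv_lt_contravar; lra. }
apply is_series_ext with (fun n => scal (/ q ^ j) ((/ q) ^ n)).
- intros n; unfold scal; simpl; unfold mult; simpl.
  rewrite pow_add, Rinv_mult, pow_inv; ring.
- apply (is_series_scal_l (V := R_NormedModule)).
  apply is_series_geom, Hq.
Qed.

Lemma ex_series_bounded_weighted q j (a : nat -> R) B : 1 < q ->
  (forall n, Rabs (a n) <= B) -> ex_series (fun n => / q ^ (n + j) * a n).
Proof.
intros hq Ha.
apply (ex_series_le (V := R_CompleteNormedModule)) with
  (fun n => / q ^ (n + j) * B).
- intros n; unfold norm; simpl; unfold abs; simpl.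
  assert (Hw := geometric_weight_pos q (n + j) hq).
  rewrite Rabs_mult, (Rabs_pos_eq (/ q ^ (n + j))) by lra.
  apply Rmult_le_compat_l; [lra | apply Ha].
- apply ex_series_scal_r. eexists; apply is_series_geometric_weight, hq.
Qed.

Definition Sq_der (m : nat) (q x : R) : R :=
  sum_from_2 (fun i => / q ^ i * phi_der m i x).

Lemma phi_der_bound_all m i x : (1 <= i)%nat ->
  Rabs (phi_der m i x) <= (2 * PI) ^ m.
Proof.
intros Hi; destruct m as [|m].
- rewrite phi_der_0, Rabs_pos_eq by (apply phi_nonneg, Hi).
  apply phi_le_1, Hi.
- eapply Rle_trans; [apply phi_der_bound, Hi|].
  assert (0 < (2 * PI) ^ S m) by (apply pow_lt; assert (H := PI_RGT_0); lra).
  lra.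
Qed.

Lemma ex_series_Sq_der m q x : 1 < q ->
  ex_series (fun n => / q ^ (n + 2) * phi_der m (n + 2) x).
Proof.
intros hq; apply ex_series_bounded_weighted with ((2 * PI) ^ m); [exact hq|].
intros n; apply phi_der_bound_all; lia.
Qed.

Lemma is_derive_Sq_der m q x : 1 < q ->
  is_derive (Sq_der m q) x (Sq_der (S m) q x).
Proof.
intros hq.
apply (is_derive_Series
  (fun n y => / q ^ (n + 2) * phi_der m (n + 2) y)
  (fun n y => / q ^ (n + 2) * phi_der (S m) (n + 2) y)
  (fun n y => / q ^ (n + 2) * phi_der (S (S m)) (n + 2) y)
  (fun n => / q ^ (n + 2) * (2 * PI) ^ S (S m))).
- intros n y; apply is_derive_scal, is_derive_phi_der.
- intros n y; apply is_derive_scal, is_derive_phi_der.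
- intros n y.
  assert (Hw := geometric_weight_pos q (n + 2) hq).
  rewrite Rabs_mult, (Rabs_pos_eq (/ q ^ (n + 2))) by lra.
  apply Rmult_le_compat_l; [lra|]. apply phi_der_bound_all; lia.
- apply ex_series_scal_r. eexists; apply is_series_geometric_weight, hq.
- intros y; apply ex_series_Sq_der, hq.
- apply ex_series_Sq_der, hq.
Qed.

Lemma Sq_der_0 q x : Sq_der 0 q x = Sq q x.
Proof.
unfold Sq_der, Sq, sum_from_2; apply Series_ext; intros n.
rewrite phi_der_0; reflexivity.
Qed.

Lemma Derive_n_Sq m q x : 1 < q -> Derive_n (Sq q) m x = Sq_der m q x.
Proof.
intros hq; apply (Derive_n_unfolded (fun m => Sq_der m q)).
- intros; apply is_derive_Sq_der, hq.
- intros; apply Sq_der_0.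
Qed.

Lemma Sq_prime q p : 1 < q -> prime p -> Sq q (IZR p) = Rpower q (- IZR p).
Proof.
intros hq Hp.
assert (Hp2 : (2 <= p)%Z) by (destruct Hp; lia).
unfold Sq, sum_from_2.
rewrite (is_series_unique _ _ (is_series_single
  (fun n => / q ^ (n + 2) * phi (n + 2) (IZR p)) (Z.to_nat p - 2)
  ltac:(intros n Hn; simpl; rewrite phi_prime; [ring | exact Hp | lia | lia]))).
replace (Z.to_nat p - 2 + 2)%nat with (Z.to_nat p) by lia.
rewrite phi_self by lia.
rewrite Rpower_Ropp, Rmult_1_r; f_equal.
rewrite <- Rpower_pow by lra; f_equal.
rewrite INR_IZR_INZ, Z2Nat.id by lia; reflexivity.
Qed.

Lemma Sq_der_1_at_integer q z : Sq_der 1 q (IZR z) = 0.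
Proof.
unfold Sq_der, sum_from_2.
rewrite (Series_ext _ (fun n => 0 * / q ^ (n + 2)))
  by (intros n; rewrite phi_der_1_at_integer by lia; ring).
rewrite Series_scal_l; ring.
Qed.

Lemma Sq_ge_first_term q x : 1 < q -> / q ^ 2 * phi 2 x <= Sq q x.
Proof.
intros hq; unfold Sq, sum_from_2.
assert (He : ex_series (fun n => / q ^ (n + 2) * phi (n + 2) x)).
{ eapply ex_series_ext; [|exact (ex_series_Sq_der 0 q x hq)].
  intros n; cbv beta; rewrite phi_der_0; reflexivity. }
rewrite Series_incr_1 by exact He.
simpl (0 + 2)%nat.
assert (0 <= Series (fun k => / q ^ (S k + 2) * phi (S k + 2) x)).
{ replace 0 with (Series (fun k => 0 * (/ q ^ (S k + 2) * phi (S k + 2) x)))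
    by (rewrite Series_scal_l; ring).
  apply Series_le.
  - intros n.
    assert (0 <= / q ^ (S n + 2) * phi (S n + 2) x).
    { apply Rmult_le_pos; [apply Rlt_le, geometric_weight_pos, hq|].
      apply phi_nonneg; lia. }
    lra.
  - apply (ex_series_incr_1 (V := R_NormedModule)
      (fun n => / q ^ (n + 2) * phi (n + 2) x)), He. }
lra.
Qed.

Lemma Sq_ge_sin q x : 1 < q ->
  sin (PI * x) ^ 2 * sum_from_2 (fun i => / q ^ i / INR i ^ 2) <= Sq q x.
Proof.
intros hq; unfold Sq, sum_from_2.
rewrite <- Series_scal_l.
apply Series_le.
- intros n.
  assert (Hw := geometric_weight_pos q (n + 2) hq).
  assert (Hi : 0 < INR (n + 2) ^ 2) by (apply pow_lt, lt_0_INR; lia).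
  assert (Hs := pow2_ge_0 (sin (PI * x))).
  assert (Hl := phi_lower_bound (n + 2) x ltac:(lia)).
  replace (sin (PI * x) ^ 2 * (/ q ^ (n + 2) / INR (n + 2) ^ 2))
    with (/ q ^ (n + 2) * (sin (PI * x) ^ 2 / INR (n + 2) ^ 2))
    by (unfold Rdiv; ring).
  split.
  + apply Rmult_le_pos; [lra|].
    apply Rmult_le_pos; [lra|]. apply Rlt_le, Rinv_0_lt_compat, Hi.
  + apply Rmult_le_compat_l; lra.
- eapply ex_series_ext; [|exact (ex_series_Sq_der 0 q x hq)].
  intros n; cbv beta; rewrite phi_der_0; reflexivity.
Qed.

(** The supremum is finite because the sums are bounded uniformly in [x]. *)
Lemma Sq_der_3_le_T3 p q alpha x : 1 < q -> Rabs (x - IZR p) <= alpha ->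
  Rabs (Sq_der 3 q x) <= T3 p q alpha.
Proof.
intros hq Hx.
assert (Hterm : forall i y, (2 <= i)%nat ->
  Rabs (Derive_n (phi i) 3 y) <= (2 * PI) ^ 3).
{ intros i y Hi; rewrite Derive_n_phi; apply phi_der_bound_all; lia. }
assert (Hle : Rabs (Sq_der 3 q x)
  <= sum_from_2 (fun i => / q ^ i * Rabs (Derive_n (phi i) 3 x))).
{ unfold Sq_der, sum_from_2.
  rewrite (Series_ext (fun n => / q ^ (n + 2) * Rabs (Derive_n (phi (n + 2)) 3 x))
    (fun n => Rabs (/ q ^ (n + 2) * phi_der 3 (n + 2) x))).
  - apply Series_Rabs.
    eapply ex_series_ext; [|apply (ex_series_bounded_weighted q 2
      (fun n => Rabs (phi_der 3 (n + 2) x)) ((2 * PI) ^ 3) hq)].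
    + intros n; cbv beta.
      rewrite Rabs_mult, (Rabs_pos_eq (/ q ^ (n + 2)))
        by (apply Rlt_le, geometric_weight_pos, hq); reflexivity.
    + intros n; rewrite Rabs_Rabsolu; apply phi_der_bound_all; lia.
  - intros n; rewrite Derive_n_phi, Rabs_mult, (Rabs_pos_eq (/ q ^ (n + 2)))
      by (apply Rlt_le, geometric_weight_pos, hq); reflexivity. }
eapply Rle_trans; [exact Hle|].
unfold T3.
set (E := fun y : R => exists x0 : R, Rabs (x0 - IZR p) <= alpha /\
    y = sum_from_2 (fun i => / q ^ i * Rabs (Derive_n (phi i) 3 x0))).
destruct (Lub_Rbar_correct E) as [Hub Hleast].
assert (Hin : E (sum_from_2 (fun i => / q ^ i * Rabs (Derive_n (phi i) 3 x))))
  by (exists x; split; [exact Hx | reflexivity]).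
assert (Hfin : Rbar_le (Lub_Rbar E)
  (sum_from_2 (fun i => / q ^ i * (2 * PI) ^ 3))).
{ apply Hleast; intros y [x0 [_ ->]]; simpl; unfold sum_from_2.
  apply Series_le.
  - intros n; assert (Hw := geometric_weight_pos q (n + 2) hq); split.
    + apply Rmult_le_pos; [lra | apply Rabs_pos].
    + apply Rmult_le_compat_l; [lra | apply Hterm; lia].
  - apply ex_series_scal_r. eexists; apply is_series_geometric_weight, hq. }
specialize (Hub _ Hin).
destruct (Lub_Rbar E); simpl in *; [exact Hub | contradiction | contradiction].
Qed.

(** * Counting zeros *)

(** A positive slope at the zero [p] produces a negative value just before [p],
    hence a zero by continuity; with a second zero in [(c, p)], Rolle's theorem
    applied twice to the three zeros would make [f2] vanish. *)
Lemma unique_zero_before (f f1 f2 : R -> R) a c p :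
  a < c < p ->
  (forall x, is_derive f x (f1 x)) -> (forall x, is_derive f1 x (f2 x)) ->
  f p = 0 -> 0 < f1 p ->
  (forall x, c <= x <= p -> 0 < f2 x) ->
  (forall x, a < x <= c -> 0 < f x) ->
  exists! x, a < x < p /\ f x = 0.
Proof.
intros Hac H1 H2 Hp Hp1 Hconv Hpos.
assert (Hrolle : forall g g1 u v, (forall x, is_derive g x (g1 x)) -> u < v ->
  g u = g v -> exists t, u < t < v /\ g1 t = 0).
{ intros g g1 u v Hg Huv He.
  destruct (MVT_cor2 g g1 u v Huv) as [t [Ht Hb]].
  - intros t _; apply is_derive_Reals, Hg.
  - exists t; split; [exact Hb|].
    rewrite He, Rminus_diag in Ht.
    symmetry in Ht; apply Rmult_integral in Ht; destruct Ht as [Ht|Ht]; lra. }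
assert (Huniq : forall x y, c < x < p -> c < y < p -> x < y ->
  f x = 0 -> f y = 0 -> False).
{ intros x y Hx Hy Hxy Ex Ey.
  destruct (Hrolle f f1 x y H1 Hxy) as [s [Hs Es]]; [lra|].
  destruct (Hrolle f f1 y p H1) as [t [Ht Et]]; [lra | lra |].
  destruct (Hrolle f1 f2 s t H2) as [r [Hr Er]]; [lra | lra |].
  assert (H := Hconv r); lra. }
assert (Hneg : exists y, c < y < p /\ f y < 0).
{ destruct (proj1 (is_derive_Reals _ _ _) (H1 p) (f1 p) Hp1) as [d Hd].
  set (h := Rmin (d / 2) ((p - c) / 2)).
  assert (Hh : 0 < h <= d / 2 /\ h <= (p - c) / 2).
  { assert (Hd0 := cond_pos d).
    unfold h; split; [split|]; [apply Rmin_glb_lt; lra | apply Rmin_l | apply Rmin_r]. }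
  exists (p + - h); split; [lra|].
  specialize (Hd (- h)).
  rewrite Rabs_Ropp, Rabs_pos_eq in Hd by lra.
  assert (Hd0 := cond_pos d).
  specialize (Hd ltac:(lra) ltac:(lra)).
  rewrite Hp, Rminus_0_r in Hd.
  apply Rabs_def2 in Hd; destruct Hd as [_ Hd].
  assert (Hq : 0 < f (p + - h) / - h) by lra.
  replace (f (p + - h)) with (- (f (p + - h) / - h * h)) by (field; lra).
  nra. }
destruct Hneg as [y [Hy Hfy]].
destruct (IVT_gen f c y 0) as [z [Hz Ez]].
{ intros x; apply continuity_pt_filterlim.
  apply (ex_derive_continuous f); exists (f1 x); apply H1. }
{ assert (Hc := Hpos c ltac:(lra)).
  rewrite Rmin_right, Rmax_left by lra; lra. }
rewrite Rmin_left, Rmax_right in Hz by lra.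
assert (Hzc : c < z).
{ destruct (Rle_lt_or_eq_dec c z (proj1 Hz)) as [H|H]; [exact H|].
  assert (Hc := Hpos c ltac:(lra)); rewrite H, Ez in Hc; lra. }
exists z; split; [split; [lra | exact Ez]|].
intros x [Hx Ex].
destruct (Rle_or_lt x c) as [Hxc|Hxc].
{ assert (H := Hpos x ltac:(lra)); lra. }
destruct (Rtotal_order z x) as [H|[H|H]]; [exfalso | exact H | exfalso].
- apply (Huniq z x); lra.
- apply (Huniq x z); lra.
Qed.

(** * The two regions without zeros *)

Lemma Rpower_neg_lt q x y : 1 < q -> y < x -> Rpower q (- x) < Rpower q (- y).
Proof. intros; apply Rpower_lt; lra. Qed.

(** Near the even integer [2 * k], the term of index [2] alone is at least
    [q ^ -4], and [x > 4]. *)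
Lemma Sq_gt_near_even q k alpha x : 1 < q -> (2 <= k)%nat ->
  0 < alpha < 1 / 2 -> cos (PI * alpha / 2) ^ 2 >= / q ^ 2 ->
  2 * INR k < x <= 2 * INR k + alpha -> Rpower q (- x) < Sq q x.
Proof.
intros hq Hk Ha Hc Hx.
assert (HPI := PI_RGT_0).
assert (Hk2 : 2 <= INR k) by (apply (le_INR 2); exact Hk).
apply Rlt_le_trans with (/ q ^ 2 * / q ^ 2).
- apply Rlt_le_trans with (Rpower q (- (4))).
  + apply Rpower_neg_lt; [exact hq | lra].
  + apply Req_le. rewrite Rpower_Ropp.
    replace 4 with (INR 4) by (simpl; ring).
    rewrite Rpower_pow by lra. field; lra.
- eapply Rle_trans; [|apply Sq_ge_first_term, hq].
  apply Rmult_le_compat_l; [apply Rlt_le, geometric_weight_pos, hq|].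
  rewrite phi_2.
  assert (Hcos : cos (PI * x / 2) ^ 2 = cos (PI * (x - 2 * INR k) / 2) ^ 2).
  { assert (H1 := cos_2a_cos (PI * x / 2)).
    assert (H2 := cos_2a_cos (PI * (x - 2 * INR k) / 2)).
    assert (H3 := cos_period (2 * (PI * (x - 2 * INR k) / 2)) k).
    replace (2 * (PI * (x - 2 * INR k) / 2) + 2 * INR k * PI)
      with (2 * (PI * x / 2)) in H3 by field.
    simpl; lra. }
  rewrite Hcos.
  assert (Hdec : cos (PI * alpha / 2) <= cos (PI * (x - 2 * INR k) / 2))
    by (apply cos_decr_1; nra).
  assert (0 <= cos (PI * alpha / 2)) by (apply cos_ge_0; nra).
  assert (cos (PI * alpha / 2) ^ 2 <= cos (PI * (x - 2 * INR k) / 2) ^ 2)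
    by (apply pow_incr; lra).
  lra.
Qed.

Lemma sin_sqr_ge k alpha x : 0 < alpha < 1 / 2 ->
  2 * INR k + alpha <= x <= 2 * INR k + 1 - alpha ->
  sin (PI * alpha) ^ 2 <= sin (PI * x) ^ 2.
Proof.
intros Ha Hx.
assert (HPI := PI_RGT_0).
replace (PI * x) with (PI * (x - 2 * INR k) + 2 * INR k * PI) by ring.
rewrite sin_period.
set (t := x - 2 * INR k).
assert (Ht : alpha <= t <= 1 - alpha) by (unfold t; lra).
apply pow_incr; split.
- apply sin_ge_0; nra.
- destruct (Rle_or_lt t (1 / 2)) as [H|H].
  + apply sin_incr_1; nra.
  + rewrite <- (sin_PI_x (PI * t)).
    apply sin_incr_1; nra.
Qed.

Lemma Sq_gt_middle q k alpha x : 1 < q -> (2 <= k)%nat ->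
  0 < alpha < 1 / 2 ->
  sin (PI * alpha) ^ 2 * sum_from_2 (fun i => / q ^ i / INR i ^ 2)
    >= Rpower q (- 4 - alpha) ->
  2 * INR k + alpha < x <= 2 * INR k + 1 - alpha -> Rpower q (- x) < Sq q x.
Proof.
intros hq Hk Ha Hs Hx.
assert (Hk2 : 2 <= INR k) by (apply (le_INR 2); exact Hk).
apply Rlt_le_trans with (Rpower q (- 4 - alpha)).
- replace (- 4 - alpha) with (- (4 + alpha)) by ring.
  apply Rpower_neg_lt; [exact hq | lra].
- eapply Rle_trans; [|apply Sq_ge_sin, hq].
  eapply Rle_trans; [apply Rge_le, Hs|].
  apply Rmult_le_compat_r.
  + assert (Hpos : 0 < sin (PI * alpha) ^ 2).
    { apply pow_lt, sin_gt_0; assert (HPI := PI_RGT_0); nra. }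
    assert (HR : 0 < Rpower q (- 4 - alpha)) by apply exp_pos.
    apply Rnot_lt_le; intros Hn; nra.
  + apply sin_sqr_ge with k; lra.
Qed.

(** * Convexity to the left of the prime *)

(** The term of index [2] contributes [PI ^ 2 / 2 * q ^ -2]; the remaining ones
    are at most a geometric series. *)
Lemma Sq_der_2_lower_bound q k : 7 <= q ->
  3 / 2 * / q ^ 2 <= Sq_der 2 q (2 * INR k + 1).
Proof.
intros hq7.
assert (hq : 1 < q) by lra.
set (x := 2 * INR k + 1).
assert (HPI := PI_RGT_0).
assert (HPI3 : 3 < PI) by (assert (H := PI2_3_2); lra).
assert (H2 : phi_der 2 2 x = PI ^ 2 / 2).
{ unfold phi_der; simpl (2 - 1)%nat.
  rewrite sum_from_1_S, sum_from_1_0.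
  replace (2 * PI * INR 1 / INR 2 * x + INR 2 * (PI / 2))
    with (0 + 2 * INR (k + 1) * PI)
    by (unfold x; rewrite plus_INR; simpl; field).
  rewrite cos_period, cos_0; simpl; field. }
assert (He := ex_series_Sq_der 2 q x hq).
unfold Sq_der, sum_from_2.
rewrite Series_incr_1 by exact He.
simpl (0 + 2)%nat; rewrite H2.
assert (Hgeo := is_series_geometric_weight q 3 hq).
assert (Htail : Rabs (Series (fun n => / q ^ (S n + 2) * phi_der 2 (S n + 2) x))
  <= / q ^ 3 / (1 - / q) * (2 * PI ^ 2)).
{ rewrite <- (is_series_unique _ _ Hgeo), <- Series_scal_r.
  assert (Hb : forall n, Rabs (/ q ^ (S n + 2) * phi_der 2 (S n + 2) x)
    <= / q ^ (n + 3) * (2 * PI ^ 2)).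
  { intros n.
    assert (Hw := geometric_weight_pos q (n + 3) hq).
    replace (S n + 2)%nat with (n + 3)%nat by lia.
    rewrite Rabs_mult, (Rabs_pos_eq (/ q ^ (n + 3))) by lra.
    apply Rmult_le_compat_l; [lra|].
    eapply Rle_trans; [apply phi_der_bound; lia|]. simpl; lra. }
  assert (Hex : ex_series (fun n => / q ^ (n + 3) * (2 * PI ^ 2)))
    by (apply ex_series_scal_r; eexists; exact Hgeo).
  eapply Rle_trans; [apply Series_Rabs|].
  - apply (ex_series_le (V := R_CompleteNormedModule)) with (2 := Hex).
    intros n; unfold norm; simpl norm; unfold abs; simpl abs.
    rewrite Rabs_Rabsolu; apply Hb.
  - apply Series_le; [|exact Hex].
    intros n; split; [apply Rabs_pos | apply Hb]. }
assert (Hw := geometric_weight_pos q 2 hq).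
assert (Hgeo6 : / q ^ 3 / (1 - / q) <= / q ^ 2 / 6).
{ replace (/ q ^ 3 / (1 - / q)) with (/ q ^ 2 * / (q - 1)) by (field; lra).
  unfold Rdiv; apply Rmult_le_compat_l; [lra|].
  apply Rinv_le_contravar; lra. }
apply Rabs_le_between in Htail; destruct Htail as [Htail _].
assert (HP2 : 9 <= PI ^ 2) by (simpl; nra).
nra.
Qed.

Lemma exp_taylor_2 u : 0 <= u -> 1 + u + u ^ 2 / 2 <= exp u.
Proof.
intros Hu; eapply Rle_trans; [|apply (exp_ge_taylor u 2 Hu)].
simpl; lra.
Qed.

(** By convexity of [exp], as [exp 1 <= 3]. *)
Lemma exp_lt_chord u : 0 < u < 1 -> exp u < 1 + 2 * u.
Proof.
intros Hu.
destruct (MVT_cor2 exp exp 0 u) as [s [Hs Hsb]];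
  [lra | intros; apply derivable_pt_lim_exp|].
destruct (MVT_cor2 exp exp u 1) as [t [Ht Htb]];
  [lra | intros; apply derivable_pt_lim_exp|].
assert (Hst : exp s < exp t) by (apply exp_increasing; lra).
assert (H3 := exp_le_3).
rewrite exp_0 in Hs.
destruct (Rle_or_lt 2 (exp s)) as [H|H]; nra.
Qed.

Lemma exp_2_ge_7 : 7 <= exp 2.
Proof.
eapply Rle_trans; [|apply (exp_ge_taylor 2 6); lra].
simpl; lra.
Qed.

(** With [S] the series, the bound [T] on its third derivative and monotonicity of
    [q ^ -x] make the conclusion a lower bound for the second derivative of
    [S x - q ^ -x] on [[p - alpha, p]].

    The exponential term is the delicate one, since [q ^ -x] exceeds [q ^ -p] by
    up to the factor [exp u] with [u = alpha * ln q]. The hypothesis on [alpha]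
    says that [S'' p] is at least [2 * alpha * T] plus [1 + 2 * u] times
    [(ln q) ^ 2 * q ^ -p], and [exp u < 1 + 2 * u] for [u < 1]. When [1 <= u], [q] exceeds [exp 2 >= 7] because
    [alpha < 1 / 2]; then [S'' p] is of order [q ^ -2], whereas [(ln q) ^ 2 <= 2 * q]
    and [exp u <= q] bound the exponential term by [2 * q ^ -3]. *)
Lemma second_derivative_margin q k p T alpha :
  1 < q -> (2 <= k)%nat -> p = 2 * INR k + 1 -> 0 < alpha < 1 / 2 -> 0 <= T ->
  alpha <= / 2 * (Sq_der 2 q p - ln q ^ 2 * Rpower q (- p)) / (T + ln q ^ 3 * Rpower q (- p)) ->
  0 < Sq_der 2 q p - alpha * T
      - ln q ^ 2 * (Rpower q (- p) * exp (alpha * ln q)).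
Proof.
intros hq Hk Hp Ha HT HK.
set (S2 := Sq_der 2 q p) in *.
assert (Hk2 : 2 <= INR k) by (apply (le_INR 2); exact Hk).
assert (Hs : 0 < ln q) by (rewrite <- ln_1; apply ln_increasing; lra).
assert (Hr : 0 < Rpower q (- p)) by apply exp_pos.
apply Rle_div_r in HK.
2:{ assert (0 < ln q ^ 3 * Rpower q (- p)) by (apply Rmult_lt_0_compat; [apply pow_lt|]; auto).
    lra. }
set (s := ln q) in *; set (r := Rpower q (- p)) in *.
set (u := alpha * s).
assert (Hu : 0 < u) by (unfold u; nra).
assert (Hs2 : 0 < s ^ 2) by (apply pow_lt, Hs).
assert (Hsr : 0 < s ^ 2 * r) by (apply Rmult_lt_0_compat; auto).
assert (HK' : alpha * T + u * (s ^ 2 * r) <= / 2 * (S2 - s ^ 2 * r)).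
{ replace (u * (s ^ 2 * r)) with (alpha * (s ^ 3 * r)) by (unfold u; ring). lra. }
assert (HaT : 0 <= alpha * T) by (apply Rmult_le_pos; lra).
destruct (Rlt_or_le u 1) as [Hu1|Hu1].
- assert (He := exp_lt_chord u ltac:(lra)).
  assert (Hp' : s ^ 2 * r * exp u < s ^ 2 * r * (1 + 2 * u))
    by (apply Rmult_lt_compat_l; lra).
  lra.
- assert (Hs2' : 2 < s) by (unfold u in Hu1; nra).
  assert (Hqs : exp s = q) by (apply exp_ln; lra).
  assert (Hq7 : 7 <= q).
  { rewrite <- Hqs; eapply Rle_trans; [apply exp_2_ge_7|].
    apply Rlt_le, exp_increasing, Hs2'. }
  assert (Hlow := Sq_der_2_lower_bound q k Hq7).
  rewrite <- Hp in Hlow; fold S2 in Hlow.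
  assert (Hsq : s ^ 2 <= 2 * q).
  { assert (H := exp_taylor_2 s ltac:(lra)); rewrite Hqs in H; lra. }
  assert (Hr5 : r <= / q ^ 5).
  { unfold r; rewrite <- Rpower_pow, <- Rpower_Ropp by lra.
    apply Rle_Rpower; simpl; lra. }
  assert (Heu : exp u <= q).
  { rewrite <- Hqs; apply Rlt_le, exp_increasing; unfold u; nra. }
  assert (Hprod : s ^ 2 * (r * exp u) <= 2 * q * (/ q ^ 5 * q)).
  { apply Rmult_le_compat; [lra | | exact Hsq |].
    - apply Rmult_le_pos; [lra | apply Rlt_le, exp_pos].
    - apply Rmult_le_compat; [lra | apply Rlt_le, exp_pos | exact Hr5 | exact Heu]. }
  replace (2 * q * (/ q ^ 5 * q)) with (/ q ^ 2 * (2 * / q)) in Hprod by (field; lra).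
  assert (Hw := geometric_weight_pos q 2 hq).
  assert (Hq7' : / q <= / 7) by (apply Rinv_le_contravar; lra).
  assert (/ q ^ 2 * (2 * / q) <= / q ^ 2 * (2 * / 7)) by (apply Rmult_le_compat_l; lra).
  assert (0 < u * (s ^ 2 * r)) by (apply Rmult_lt_0_compat; auto).
  lra.
Qed.

Theorem theoremE9 (q : R) (p : Z) (alpha : R)
  (hq : 1 < q)
  (hp5 : (5 <= p)%Z) (hodd : Z.Odd p) (hp : prime p)
  (halpha : 0 < alpha < 1 / 2)
  (hcos : cos (PI * alpha / 2) ^ 2 >= / q ^ 2)
  (hsin : sin (PI * alpha) ^ 2 * sum_from_2 (fun i => / q ^ i / INR i ^ 2)
          >= Rpower q (- 4 - alpha))
  (hK : alpha <= K q p / (T3 p q alpha + ln q ^ 3 * Rpower q (- IZR p))) :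
  exists! x : R, IZR p - 1 < x < IZR p /\ frakF x q = 0.
Proof.
assert (Hk : exists k, (2 <= k)%nat /\ IZR p = 2 * INR k + 1).
{ destruct hodd as [z Hz]; exists (Z.to_nat z); split; [lia|].
  rewrite INR_IZR_INZ, Z2Nat.id, <- mult_IZR, <- plus_IZR by lia.
  f_equal; exact Hz. }
destruct Hk as [k [Hk2 Hpk]].
assert (Hs : 0 < ln q) by (rewrite <- ln_1; apply ln_increasing; lra).
set (s := ln q) in *.
assert (HE : forall c x, is_derive (fun y => c * Rpower q (- y)) x
  (- s * c * Rpower q (- x))).
{ intros c x; unfold Rpower; auto_derive; [exact I|]. fold s; ring. }
set (f := fun x => Sq_der 0 q x - 1 * Rpower q (- x)).
set (f1 := fun x => Sq_der 1 q x - (- s * 1) * Rpower q (- x)).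
set (f2 := fun x => Sq_der 2 q x - (- s * (- s * 1)) * Rpower q (- x)).
assert (Hzero : forall x, frakF x q = 0 <-> f x = 0).
{ intros x; unfold frakF, f; rewrite Sq_der_0, Rmult_1_l; split.
  - intros H; apply Rmult_integral in H; destruct H as [H|H]; [|exact H].
    apply Rmult_integral in H; lra.
  - intros ->; ring. }
assert (HT : 0 <= T3 p q alpha).
{ eapply Rle_trans; [apply Rabs_pos|].
  apply (Sq_der_3_le_T3 p q alpha (IZR p) hq).
  rewrite Rminus_diag, Rabs_R0; lra. }
unfold K in hK; rewrite Derive_n_Sq in hK by exact hq.
assert (Hmargin := second_derivative_margin q k (IZR p)
  (T3 p q alpha) alpha hq Hk2 Hpk halpha HT hK).
fold s in Hmargin.
destruct (unique_zero_before f f1 f2 (IZR p - 1) (IZR p - alpha) (IZR p))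
  as [x [[Hx Ex] Hu]].
- lra.
- intros x; apply (is_derive_minus (V := R_NormedModule));
    [apply is_derive_Sq_der, hq | apply HE].
- intros x; apply (is_derive_minus (V := R_NormedModule));
    [apply is_derive_Sq_der, hq | apply HE].
- unfold f; rewrite Sq_der_0, Sq_prime by assumption; ring.
- unfold f1; rewrite Sq_der_1_at_integer.
  assert (0 < Rpower q (- IZR p)) by apply exp_pos. nra.
- intros x Hx; unfold f2.
  assert (HS : Sq_der 2 q (IZR p) - alpha * T3 p q alpha <= Sq_der 2 q x).
  { destruct (MVT_gen (Sq_der 2 q) x (IZR p) (Sq_der 3 q)) as [c [Hc Ec]].
    - intros; apply is_derive_Sq_der, hq.
    - intros t _; apply continuity_pt_filterlim.
      apply (ex_derive_continuous (Sq_der 2 q)); exists (Sq_der 3 q t).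
      apply is_derive_Sq_der, hq.
    - rewrite Rmin_left, Rmax_right in Hc by lra.
      assert (Hb : Rabs (Sq_der 3 q c) <= T3 p q alpha)
        by (apply Sq_der_3_le_T3; [exact hq | apply Rabs_le; lra]).
      apply Rabs_le_between in Hb. nra. }
  assert (HR : Rpower q (- x) <= Rpower q (- IZR p) * exp (alpha * s)).
  { change (exp (alpha * s)) with (Rpower q alpha).
    rewrite <- Rpower_plus; apply Rle_Rpower; lra. }
  assert (0 < s ^ 2) by (apply pow_lt, Hs).
  assert (s ^ 2 * Rpower q (- x) <= s ^ 2 * (Rpower q (- IZR p) * exp (alpha * s)))
    by (apply Rmult_le_compat_l; lra).
  replace (- s * (- s * 1)) with (s ^ 2) by ring.
  lra.
- intros x Hx; unfold f; rewrite Sq_der_0, Rmult_1_l.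
  enough (Rpower q (- x) < Sq q x) by lra.
  destruct (Rle_or_lt x (2 * INR k + alpha)).
  + apply Sq_gt_near_even with k alpha; auto; lra.
  + apply Sq_gt_middle with k alpha; auto; lra.
- exists x; split.
  + split; [exact Hx | apply Hzero, Ex].
  + intros y [Hy Ey]; apply Hu; split; [exact Hy | apply Hzero, Ey].
Qed.
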